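(* For every $p\ge2$, every deterministic preemptive online algorithm for $\textsc{Part}$ has competitive ratio at least $\frac43$, and every randomized preemptive online algorithm for $\textsc{Part}$ has expected competitive ratio at least $\frac65$.
   Context: $\textsc{Part}$: given a sequence $w_1,\dots,w_n$ of positive integers and $p\ge2$, place $p-1$ separators to split it into $p$ contiguous blocks minimizing the maximum block weight (the bottleneck value). Preemptive online model: $p$ is known, requests arrive one by one ($n$ unknown); when processing the current request the algorithm may remove previously placed separators, may insert separators only right after the current request, and never has more than $p-1$ separators in place. The competitive ratio is the supremum over inputs of the (expected, for randomized algorithms) ratio between the algorithm's bottleneck value and the optimal bottleneck value. *)

(* Defs.v *)
From mathcomp Require Import all_boot all_order all_algebra.
From mathcomp Require Import all_classical all_reals all_analysis.
Set Implicit Arguments.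
Unset Strict Implicit.
Unset Printing Implicit Defensive.
Import Order.TTheory GRing.Theory Num.Theory.
Local Open Scope classical_set_scope.
Local Open Scope ring_scope.

(* A separator is encoded by the number of requests on its left; a placement
   is a nondecreasing sequence of separators.  Repeated separators, and
   separators at 0 or [size w], delimit empty blocks. *)

Definition positive_weights (w : seq nat) : bool := all (fun x => 0 < x)%N w.

Definition block_weights (w s : seq nat) : seq nat :=
  pairmap (fun i j => \sum_(i <= k < j) nth 0 w k)%N 0%N (rcons s (size w)).

Definition bottleneck (w s : seq nat) : nat :=
  (\max_(b <- block_weights w s) b)%N.

(* The default value [sumn w] of the minimum is itself attained, by putting
   all p - 1 separators at 0. *)
Definition opt (p : nat) (w : seq nat) : nat :=
  \big[minn/sumn w]_(s : (p.-1).-tuple 'I_(size w).+1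
                     | sorted leq (map val s)) bottleneck w (map val s).

(* [A w] is the placement maintained after the requests [w] have been
   processed.  Inserted separators all sit right after the current request;
   as at most p - 1 are ever in place, p - 1 copies are enough. *)
Record preemptive_online (p : nat) (A : seq nat -> seq nat) : Prop := {
  online_nil : A [::] = [::];
  online_size : forall w, positive_weights w -> (size (A w) <= p.-1)%N;
  online_step : forall w x, positive_weights (rcons w x) ->
    subseq (A (rcons w x)) (A w ++ nseq p.-1 (size w).+1) }.

(* A randomized algorithm is a random deterministic one, its coin tosses being
   the points of a probability space. *)
Record randomized_online (p : nat) (d : measure_display)
    (T : measurableType d) (A : T -> seq nat -> seq nat) : Prop := {
  randomized_preemptive : forall t, preemptive_online p (A t);
  randomized_measurable : forall w s, positive_weights w ->
    measurable [set t | A t w = s] }.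

(* The empty input is excluded: its optimal value is 0. *)
Definition inputs : set (seq nat) :=
  [set w | positive_weights w /\ w <> [::]].

Definition ratio (R : realType) (p : nat) (A : seq nat -> seq nat)
    (w : seq nat) : R :=
  (bottleneck w (A w))%:R / (opt p w)%:R.

Definition competitive_ratio (R : realType) (p : nat)
    (A : seq nat -> seq nat) : \bar R :=
  ereal_sup [set (ratio R p A w)%:E | w in inputs].

Definition expected_competitive_ratio (R : realType) (p : nat)
    (d : measure_display) (T : measurableType d) (P : probability T R)
    (A : T -> seq nat -> seq nat) : \bar R :=
  ereal_sup [set ('E_P[fun t => ratio R p (A t) w])%E | w in inputs].

(* Main.v *)
(* On unit requests, the optimum after k p of them is k, and an optimal
   placement is exactly k, 2 k, ..., (p - 1) k.  Being optimal at time 3 p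
   requires a separator at 3, which cannot be inserted after time 3 and hence
   is already there at time 2 p, where optimality allows only even positions.
   So every deterministic algorithm has ratio at least 3/2 at time 2 p or at
   least 4/3 at time 3 p.  Either way, the ratios X2 and X3 at these times
   satisfy 2 X2 + 3 X3 >= 6, and taking expectations yields 6/5. *)
Require Import Defs.
From mathcomp Require Import all_boot all_order all_algebra.
From mathcomp Require Import all_classical all_reals all_analysis.
From mathcomp Require Import measurable_realfun.
From mathcomp Require Import zify lra.
Set Implicit Arguments.
Unset Strict Implicit.
Unset Printing Implicit Defensive.
Import Order.TTheory GRing.Theory Num.Theory.
Local Open Scope nat_scope.

(** * Prefix sums bounded through block weights *)

Definition weights_below (w : seq nat) (n : nat) : nat :=
  \sum_(0 <= k < n) nth 0 w k.

Definition block_weight (w : seq nat) (i j : nat) : nat :=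
  \sum_(i <= k < j) nth 0 w k.

(** Equality can fail for [j < i], where the block is empty while the prefix sum may drop. The
    inequality telescopes along any list of separators, sorted or not. *)
Lemma weights_below_block w i j :
  weights_below w j <= weights_below w i + block_weight w i j.
Proof.
rewrite /weights_below /block_weight.
case: (leqP i j) => ij; first by rewrite -big_cat_nat.
rewrite (@big_cat_nat _ _ _ j 0 i) //=; last exact: ltnW.
by rewrite -addnA leq_addr.
Qed.

Lemma weights_below_path w k i s :
  all (leq^~ k) (pairmap (block_weight w) i s) ->
  weights_below w (last i s) <= weights_below w i + size s * k.
Proof.
elim: s i => [|j s IHs] i /=; first by rewrite mul0n addn0.
case/andP=> ijk /IHs le_last; apply: (leq_trans le_last).
rewrite mulSn addnA leq_add2r.
by apply: (leq_trans (weights_below_block w i j)); rewrite leq_add2l.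
Qed.

Lemma bottleneck_leqE w s k :
  (bottleneck w s <= k) = all (leq^~ k) (block_weights w s).
Proof.
rewrite /bottleneck; elim: (block_weights w s) => [|b r IHr] /=.
  by rewrite big_nil.
by rewrite big_cons geq_max IHr.
Qed.

(** * Placements and optimum on unit requests *)

Lemma weights_below_nseq1 n i : weights_below (nseq n 1) i = minn i n.
Proof.
rewrite /weights_below; elim: i => [|i IHi]; first by rewrite big_geq ?min0n.
by rewrite big_nat_recr //= IHi nth_nseq; case: ifP; lia.
Qed.

(** Pigeonhole: at most [p] blocks of weight at most [k - 1] cannot cover [k * p] requests. *)
Lemma unit_bottleneck_ge k p s : 0 < p -> size s <= p.-1 ->
  k <= bottleneck (nseq (k * p) 1) s.
Proof.
move=> p_gt0 size_s; rewrite leqNgt; apply/negP => ltk.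
have: bottleneck (nseq (k * p) 1) s <= k.-1 by lia.
rewrite bottleneck_leqE => /weights_below_path.
rewrite last_rcons !weights_below_nseq1 size_rcons size_nseq minnn min0n.
nia.
Qed.

(** The blocks before [x] bound its position from above, those after it from below. There are at
    most [p] blocks in all, so the two bounds meet. *)
Lemma unit_bottleneck_split k p s1 x s2 : 0 < k ->
  size (s1 ++ x :: s2) <= p.-1 ->
  bottleneck (nseq (k * p) 1) (s1 ++ x :: s2) <= k ->
  x = (size s1).+1 * k.
Proof.
move=> k_gt0.
rewrite bottleneck_leqE /block_weights -cat_rcons rcons_cat pairmap_cat.
rewrite all_cat last_rcons size_cat size_rcons => size_s.
case/andP=> /weights_below_path le1 /weights_below_path le2.
move: le1 le2; rewrite !last_rcons !weights_below_nseq1 !size_rcons size_nseq.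
rewrite minnn min0n => le1 le2.
have le_blocks : (size s1).+1 * k + (size s2).+1 * k <= k * p.
  by rewrite -mulnDl mulnC leq_mul2l; lia.
(* The last blocks have positive capacity, so the truncation in [minn x (k * p)] is inactive and the
   value found is [x] itself. *)
have : 0 < (size s2).+1 * k by rewrite muln_gt0.
lia.
Qed.

Lemma unit_bottleneck_dvdn k p s x : 0 < k ->
  size s <= p.-1 -> bottleneck (nseq (k * p) 1) s <= k -> x \in s -> k %| x.
Proof.
move=> k_gt0 size_s opt_s xs; case/splitPr: xs size_s opt_s => s1 s2 size_s opt_s.
by rewrite (unit_bottleneck_split k_gt0 size_s opt_s) dvdn_mull.
Qed.

Lemma unit_bottleneck_first k p s : 0 < k -> 1 < p ->
  size s <= p.-1 -> bottleneck (nseq (k * p) 1) s <= k -> k \in s.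
Proof.
move=> k_gt0 p_gt1; case: s => [_|x s size_s opt_s].
  rewrite bottleneck_leqE => /weights_below_path /=.
  by rewrite !weights_below_nseq1 size_nseq minnn min0n; nia.
by rewrite (@unit_bottleneck_split k p [::] x s) // mul1n mem_head.
Qed.

Lemma positive_weights_nseq1 n : positive_weights (nseq n 1).
Proof. by rewrite /positive_weights all_nseq orbT. Qed.

Lemma equal_blocks_bottleneck k p : 0 < p ->
  bottleneck (nseq (k * p) 1) [seq i * k | i <- iota 1 p.-1] <= k.
Proof.
move=> p_gt0; rewrite bottleneck_leqE /block_weights size_nseq.
have -> : rcons [seq i * k | i <- iota 1 p.-1] (k * p) = [seq i * k | i <- iota 1 p].
  rewrite -{3}(prednK p_gt0) -(addn1 p.-1) iotaD map_cat cats1 /=.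
  by rewrite add1n prednK // mulnC.
have step i : block_weight (nseq (k * p) 1) (i * k) (i.+1 * k) <= k.
  rewrite /block_weight -[leqRHS](_ : \sum_(i * k <= j < i.+1 * k) 1 = k).
    by rewrite leq_sum // => j _; rewrite nth_nseq; case: ifP.
  by rewrite sum_nat_const_nat; lia.
suff all_le n i : all (leq^~ k) (pairmap (block_weight (nseq (k * p) 1))
    (i * k) [seq j * k | j <- iota i.+1 n]) by exact: (all_le p 0).
by elim: n i => [//|n IHn] i /=; rewrite step IHn.
Qed.

Lemma geq_bigminn (I : eqType) (r : seq I) (P : pred I) (F : I -> nat) x i :
  i \in r -> P i -> \big[minn/x]_(j <- r | P j) F j <= F i.
Proof.
elim: r => [//|j r IHr]; rewrite inE big_cons => /orP[/eqP <- ->|ir Pi].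
  exact: geq_minl.
case: ifP => _; last exact: IHr.
by rewrite geq_min IHr ?orbT.
Qed.

Lemma opt_nseq1 k p : 0 < p -> opt p (nseq (k * p) 1) = k.
Proof.
move=> p_gt0; set w := nseq _ _; apply/eqP; rewrite eqn_leq; apply/andP; split.
  pose s := [seq i * k | i <- iota 1 p.-1].
  have s_bound : forall i, i \in s -> i < (size w).+1.
    move=> _ /mapP[i + ->]; rewrite mem_iota size_nseq => /andP[_ ip].
    by rewrite ltnS mulnC leq_mul2l; lia.
  have size_t : size (map (inord : nat -> 'I_(size w).+1) s) == p.-1.
    by rewrite !size_map size_iota.
  have val_t : map val (Tuple size_t) = s.
    by rewrite -map_comp map_id_in // => i /s_bound; exact: inordK.
  apply: leq_trans (equal_blocks_bottleneck k p_gt0).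
  rewrite -/s -val_t; apply: geq_bigminn; first exact: mem_index_enum.
  rewrite val_t sorted_map; apply: sub_sorted (iota_sorted 1 p.-1) => i j ij.
  by rewrite /= leq_mul2r ij orbT.
(* The lower bound must also hold for the default value of the minimum, here [k * p]. *)
apply: (big_ind (leq k)) => [|x y kx ky|s _].
- by rewrite sumn_nseq mul1n leq_pmulr.
- by rewrite leq_min kx.
- by apply: unit_bottleneck_ge; rewrite // size_map size_tuple.
Qed.

(** * Persistence of separators over time *)

Lemma preemptive_mem p A w u x : preemptive_online p A ->
  positive_weights (w ++ u) -> x <= size w -> x \in A (w ++ u) -> x \in A w.
Proof.
move=> onA; elim/last_ind: u => [|u y IHu]; first by rewrite cats0.
rewrite -rcons_cat => pos_wuy xw xA; apply: IHu => //.
  by move: pos_wuy; rewrite /positive_weights all_rcons => /andP[].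
(* A separator inserted now sits beyond [size w], so [x] was already in place one request
   earlier. *)
move/mem_subseq: (online_step onA pos_wuy) => /(_ _ xA).
rewrite mem_cat mem_nseq => /orP[//|/andP[_ /eqP x_last]].
by move: xw; rewrite x_last size_cat; lia.
Qed.

Lemma not_both_optimal p A : 1 < p -> preemptive_online p A ->
  2 < bottleneck (nseq (2 * p) 1) (A (nseq (2 * p) 1)) \/
  3 < bottleneck (nseq (3 * p) 1) (A (nseq (3 * p) 1)).
Proof.
move=> p_gt1 onA; apply/orP; rewrite !ltnNge -negb_and; apply/negP => /andP[].
have size_le n := online_size onA (positive_weights_nseq1 n).
move=> opt2 /(@unit_bottleneck_first 3 p _ isT p_gt1 (size_le _)).
have -> : nseq (3 * p) 1 = nseq (2 * p) 1 ++ nseq p 1.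
  by rewrite -nseqD; congr nseq; lia.
move=> /(preemptive_mem onA) in3.
suff: 2 %| 3 by [].
apply: (unit_bottleneck_dvdn _ (size_le _) opt2) => //; apply: in3.
  by rewrite /positive_weights all_cat !all_nseq !orbT.
(* Position 3 is already past at time [2 * p], since [p] is at least 2. *)
by rewrite size_nseq; lia.
Qed.

Local Open Scope classical_set_scope.
Local Open Scope ring_scope.

(** * Ratios on unit requests and their measurability *)

Lemma ratio_ge0 (R : realType) p A w : 0 <= Defs.ratio R p A w.
Proof. by rewrite /Defs.ratio divr_ge0. Qed.

Lemma inputs_nseq1 k p : (0 < k)%N -> (0 < p)%N -> inputs (nseq (k * p) 1%N).
Proof.
move=> k_gt0 p_gt0; split; first exact: positive_weights_nseq1.
by move/(congr1 size); rewrite size_nseq /= => /eqP; rewrite muln_eq0; lia.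
Qed.

(** Bottleneck values are integers, so missing the optimum [k] costs at least one unit. *)
Lemma ratio_lower_bounds (R : realType) p A k : (0 < k)%N -> (0 < p)%N ->
  preemptive_online p A ->
  let w := nseq (k * p) 1%N in
  1 <= Defs.ratio R p A w /\
  ((k < bottleneck w (A w))%N -> k.+1%:R / k%:R <= Defs.ratio R p A w).
Proof.
move=> k_gt0 p_gt0 onA w.
have k_pos : 0 < k%:R :> R by rewrite ltr0n.
rewrite /Defs.ratio opt_nseq1 // ler_pdivlMr // mul1r; split.
  rewrite ler_nat unit_bottleneck_ge //.
  exact: (online_size onA (positive_weights_nseq1 _)).
by move=> ltkb; rewrite ler_pM2r ?invr_gt0 // ler_nat.
Qed.

(** There are countably many placements, so the preimage of any set is a countable union of events
    [A t w = s]. *)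
Lemma measurable_ratio (R : realType) p d (T : measurableType d)
    (A : T -> seq nat -> seq nat) w :
  randomized_online p A -> positive_weights w ->
  measurable_fun setT (fun t => Defs.ratio R p (A t) w).
Proof.
move=> onA pos_w _ Y _; rewrite setTI.
pose g s : R := (bottleneck w s)%:R / (opt p w)%:R.
have -> : (fun t => Defs.ratio R p (A t) w) @^-1` Y =
    \bigcup_s [set t | A t w = s /\ Y (g s)].
  by apply/seteqP; split=> t /= => [Yt|[s _ [<-]]] //; exists (A t w).
apply: countable_bigcupT_measurable => // s.
have [Ys|nYs] := pselect (Y (g s)).
  rewrite (_ : [set _ | _] = [set t | A t w = s]).
    exact: randomized_measurable onA _ _ pos_w.
  by apply/seteqP; split=> t => [[]|].
by rewrite (_ : [set _ | _] = set0) //; apply/seteqP; split=> t // [].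
Qed.

Theorem theorem10 (R : realType) (p : nat) (hp : (2 <= p)%N) :
  (forall A : seq nat -> seq nat,
     preemptive_online p A ->
     ((4 / 3 : R)%:E <= competitive_ratio R p A)%E)
  /\
  (forall (d : measure_display) (T : measurableType d) (P : probability T R)
      (A : T -> seq nat -> seq nat),
     randomized_online p A ->
     ((6 / 5 : R)%:E <= expected_competitive_ratio p P A)%E).
Proof.
have p_gt0 : (0 < p)%N by exact: ltnW.
have in2 := @inputs_nseq1 2 p isT p_gt0.
have in3 := @inputs_nseq1 3 p isT p_gt0.
set w2 := nseq (2 * p) 1%N in in2; set w3 := nseq (3 * p) 1%N in in3.
split=> [A onA|d T P A onA].
  have [_ bad2] := @ratio_lower_bounds R p A 2 isT p_gt0 onA.
  have [_ bad3] := @ratio_lower_bounds R p A 3 isT p_gt0 onA.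
  case: (not_both_optimal hp onA) => [/bad2|/bad3] bad.
    apply: ereal_sup_ge; exists (Defs.ratio R p A w2)%:E; first by exists w2.
    by rewrite lee_fin; apply: le_trans bad; lra.
  by apply: ereal_sup_ge; exists (Defs.ratio R p A w3)%:E; first by exists w3.
pose X2 t := Defs.ratio R p (A t) w2; pose X3 t := Defs.ratio R p (A t) w3.
have mX2 : measurable_fun setT X2 := measurable_ratio onA in2.1.
have mX3 : measurable_fun setT X3 := measurable_ratio onA in3.1.
(* The weights 2 and 3 balance the two cases: [2 * (3/2) + 3 * 1 = 2 * 1 + 3 * (4/3) = 6]. *)
have X_ge t : 6 <= 2 * X2 t + 3 * X3 t.
  have onAt := randomized_preemptive onA t.
  have [one2 bad2] := @ratio_lower_bounds R p (A t) 2 isT p_gt0 onAt.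
  have [one3 bad3] := @ratio_lower_bounds R p (A t) 3 isT p_gt0 onAt.
  rewrite -/(X2 t) -/(X3 t) in one2 bad2 one3 bad3.
  by case: (not_both_optimal hp onAt) => [/bad2|/bad3] bad; lra.
(* Linearity is taken from nonnegative integrals, which allows infinite values and asks only for
   measurability. *)
have E_ge : (6%:E <= 2%:E * 'E_P[X2] + 3%:E * 'E_P[X3])%E.
  rewrite unlock -!ge0_integralZl_EFin //; last 4 first.
  - by move=> t _; rewrite lee_fin ratio_ge0.
  - exact/measurable_EFinP.
  - by move=> t _; rewrite lee_fin ratio_ge0.
  - exact/measurable_EFinP.
  rewrite -ge0_integralD //; last 4 first.
  - by move=> t _; rewrite mule_ge0 // lee_fin ratio_ge0.
  - exact/measurable_EFinP/measurable_funM.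
  - by move=> t _; rewrite mule_ge0 // lee_fin ratio_ge0.
  - exact/measurable_EFinP/measurable_funM.
  rewrite -[leLHS](expectation_cst P) unlock; apply: ge0_le_integral => //.
  - by move=> t _; rewrite lee_fin.
  - exact/measurable_EFinP/measurable_cst.
  - by apply: emeasurable_funD; exact/measurable_EFinP/measurable_funM.
  - by move=> t _; rewrite -!EFinM -EFinD lee_fin.
set S := expected_competitive_ratio p P A.
have E2_le : ('E_P[X2] <= S)%E by apply: ereal_sup_ubound; exists w2.
have E3_le : ('E_P[X3] <= S)%E by apply: ereal_sup_ubound; exists w3.
have : (6%:E <= 2%:E * S + 3%:E * S)%E.
  by apply: (le_trans E_ge); rewrite leeD // lee_wpmul2l.
(* A finite supremum satisfies [6 <= 5 * s]; minus infinity would contradict the inequality. *)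
case: S {E2_le E3_le} => [s| |].
- by rewrite -!EFinM -EFinD !lee_fin; lra.
- by rewrite leey.
- by rewrite !gt0_muleNy.
Qed.
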